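(* Let $(W^*,a^*,\lambda^*,Z^* )\in E\times\mathbb{R}^+\times\mathcal{P}_W$ be a solution, together with its related Lagrange multipliers, of the one-sided limited liability problem $\sup_{(W,a)\in C_m}\mathbb{E}[U_P(X^a-W)]$. Then: (1) $(W^*,a^* )$ saturates the participation constraint: $\mathbb{E}[U_A(W^*-\kappa(a^* ))]=U_A(y)$. (2) (Borch rule for one-sided limited liability) On the event $\{Z^*=0\}$ the ratio of marginal utilities of the Principal and the Agent is constant: $\mathbb{P}$-a.s. on $\{Z^*=0\}$, $$\lambda^*=\frac{\tilde U_P'(X^{a^*}-W^* )}{\tilde U_A'(W^*-\kappa(a^* ))}\,\mathbf{1}_{Z^*=0}.$$ (3) The optimal action is greater than or equal to $\frac1K$ (the optimal action of the standard risk-sharing problem, without limited liability): $a^*\ge\frac1K$.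
   Context: Let $\Omega$ be an uncountable sample space, $(\Omega,\mathbb{F},\mathbb{P})$ a probability space, $L^2(\Omega)$ the square-integrable real random variables, and $B\in L^2(\Omega)$. Fix $x_0\in\mathbb{R}$, $K>0$; set $X^a=x_0+a+B$ and $\kappa(a)=K a^2/2$. $E=L^2(\Omega)\times\mathbb{R}$. The utility functions $U_P,U_A:\mathbb{R}\to\mathbb{R}$ are continuous, twice differentiable, with $U_P'>0$, $U_P''\le 0$, $U_A'>0$, $U_A''\le 0$ and limit $-\infty$ at $-\infty$. Fix $0\le m\le y$ and assume $\mathbb{E}[|U_P(X^0-y)|]<\infty$. Define $C_m=\{(W,a)\in E: m\le W\ \mathbb{P}\text{-a.s.},\ \mathbb{E}[U_A(W-\kappa(a))]\ge U_A(y)\}$, $\mathcal{P}_W=\{Z\in L^2(\Omega): Z\ge0\ \mathbb{P}\text{-a.s.}\}$, $\tilde U_P=-U_P$, $\tilde U_A=-U_A$. It is assumed throughout that the problem admits a maximizer and that the expected utilities $(W,a)\mapsto\mathbb{E}[U_P(X^a-W)]$ and $(W,a)\mapsto\mathbb{E}[U_A(W-\kappa(a))]$ are Gâteaux differentiable. ''A solution together with its related Lagrange multipliers'' means: $(W^*,a^* )\in C_m$ is a maximizer (optimal actions may be taken nonnegative), and $\lambda^*\in\mathbb{R}^+=[0,\infty)$, $Z^*\in\mathcal{P}_W$ satisfy the stationarity and slackness conditions (the expectations involved being finite): $\mathbb{E}[\tilde U_P'(X^{a^*}-W^* )]-\lambda^*\kappa'(a^* )\mathbb{E}[\tilde U_A'(W^*-\kappa(a^*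 ))]=0$; $-\tilde U_P'(X^{a^*}-W^* )+\lambda^*\tilde U_A'(W^*-\kappa(a^* ))-Z^*=0$ $\mathbb{P}$-a.s.; $\lambda^*(\mathbb{E}[U_A(W^*-\kappa(a^* ))]-U_A(y))=0$; $\mathbb{E}[Z^*(W^*-m)]=0$. *)

(* Defs.v *)
From HB Require Import structures.
From mathcomp Require Import all_boot all_order all_algebra.
From mathcomp Require Import all_classical all_reals all_analysis.

Set Implicit Arguments.
Unset Strict Implicit.
Unset Printing Implicit Defensive.
Import Order.TTheory GRing.Theory Num.Theory.
Import numFieldNormedType.Exports.

Local Open Scope ring_scope.
Local Open Scope classical_set_scope.

(* Square-integrable random variables, before quotienting by almost sure
   equality: every notion below depends on its arguments only up to a.s.
   equality. *)
Notation L2 P := (LfunType P (lee1n 2)).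

(* The space of contracts L^2 x R, with its pointwise vector space structure. *)
Notation contracts P R := (L2 P * R^o)%type.

Section Gateaux.
Context d (T : measurableType d) (R : realType) (P : probability T R).

(* Norm of L^2 x R, inducing the product topology. *)
Definition contract_norm (h : contracts P R) : R :=
  fine ('N[P]_(2%:E)[EFin \o (h.1 : T -> R)])%E + `|h.2|.

(* Gateaux differentiability at every point of L^2 x R: the functional is
   finite, and at each point the directional derivatives are given by a
   continuous linear form. *)
Definition gateaux_differentiable (F : contracts P R -> \bar R) : Prop :=
  (forall x, F x \is a fin_num) /\
  forall x, exists D : {linear (contracts P R) -> R^o},
    (exists M : R, forall h, `|D h| <= M * contract_norm h) /\
    forall h : contracts P R,
      t^-1 * (fine (F (x + t *: h)) - fine (F x)) @[t --> 0^'] --> (D h : R).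

End Gateaux.

Section PrincipalAgent.
Context d (T : measurableType d) (R : realType) (P : probability T R).

Definition utility (U : R -> R) : Prop :=
  [/\ continuous U,
      forall x, derivable U x 1,
      forall x, derivable U^`() x 1,
      forall x, 0 < U^`() x &
      forall x, U^`(2) x <= 0].

Definition outcome (x0 : R) (B : T -> R) (a : R) : T -> R :=
  fun w => x0 + a + B w.

Definition cost (K a : R) : R := K * a ^+ 2 / 2.

Definition marginal_cost (K : R) : R -> R := (cost K)^`().

(* For a concave U and a square-integrable argument the positive part of the
   utility is integrable, so these expectations are well defined in
   [-oo, +oo[. *)
Definition principal_utility (UP : R -> R) (x0 : R) (B : T -> R)
    (x : contracts P R) : \bar R :=
  'E_P[fun w => UP (outcome x0 B x.2 w - x.1 w)%R]%E.

Definition agent_utility (UA : R -> R) (K : R) (x : contracts P R) : \bar R :=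
  'E_P[fun w => UA (x.1 w - cost K x.2)%R]%E.

Definition admissible (UA : R -> R) (K y m : R) : set (contracts P R) :=
  [set x : contracts P R | {ae P, forall w, m <= x.1 w} /\
           ((UA y)%:E <= agent_utility UA K x)%E].

Definition maximizer (UP UA : R -> R) (x0 : R) (B : T -> R) (K y m : R)
    (x : contracts P R) : Prop :=
  admissible UA K y m x /\
  forall x', admissible UA K y m x' ->
    (principal_utility UP x0 B x' <= principal_utility UP x0 B x)%E.

(* Marginal disutilities, i.e. the derivatives of - UP and - UA, along the
   contract (W, a). *)
Definition marginal_principal (UP : R -> R) (x0 : R) (B W : T -> R) (a : R) :
    T -> R :=
  fun w => (\- UP)^`() (outcome x0 B a w - W w).

Definition marginal_agent (UA : R -> R) (K : R) (W : T -> R) (a : R) : T -> R :=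
  fun w => (\- UA)^`() (W w - cost K a).

Definition lagrange_multipliers (UP UA : R -> R) (x0 : R) (B : T -> R)
    (K y m : R) (W : L2 P) (a lam : R) (Z : L2 P) : Prop :=
  let dUP := marginal_principal UP x0 B W a in
  let dUA := marginal_agent UA K W a in
  [/\ 0 <= lam /\ {ae P, forall w, 0 <= Z w},
      [/\ P.-integrable setT (EFin \o dUP),
          P.-integrable setT (EFin \o dUA),
          P.-integrable setT (EFin \o (fun w => UA (W w - cost K a))) &
          P.-integrable setT (EFin \o (fun w => Z w * (W w - m)))],
      ('E_P[dUP] - (lam * marginal_cost K a)%:E * 'E_P[dUA] = 0)%E,
      {ae P, forall w, - dUP w + lam * dUA w - Z w = 0} &
      (lam%:E * (agent_utility UA K (W, a) - (UA y)%:E) = 0)%E /\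
      ('E_P[fun w => (Z w * (W w - m))%R] = 0)%E].

End PrincipalAgent.

(* Main.v *)
Require Import Defs.
From HB Require Import structures.
From mathcomp Require Import all_boot all_order all_algebra.
From mathcomp Require Import all_classical all_reals all_analysis.
From mathcomp Require Import ring lra.

Set Implicit Arguments.
Unset Strict Implicit.
Unset Printing Implicit Defensive.
Import Order.TTheory GRing.Theory Num.Theory.
Import numFieldNormedType.Exports.

Local Open Scope ring_scope.
Local Open Scope classical_set_scope.

(** The two stationarity conditions can be compared because both of them
involve the marginal disutilities [p] of the Principal and [q] of the Agent,
which are negative everywhere.  Stationarity in the action reads
[E p = lam * (K * a) * E q]; stationarity in the wage reads
[p = lam * q - Z], hence [p <= lam * q] almost surely.

- Since [p < 0] everywhere, [E p < 0] ([expectation_lt0]), so the first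
  condition excludes [lam = 0].  Complementary slackness then saturates the
  participation constraint.
- Where [Z = 0] the second condition is [p = lam * q] with [q != 0], which is
  the Borch rule.
- Taking expectations in [p <= lam * q] ([expectation_ae_le]) and substituting
  the first condition gives [lam * (K * a) * E q <= lam * E q].  Dividing by
  [lam * E q < 0] gives [1 <= K * a]: the limited liability multiplier [Z]
  can only push the action up. *)

Section Expectation.
Context d (T : measurableType d) (R : realType) (P : probability T R).
Implicit Types X Y : T -> R.

(** [Y - X] agrees almost surely with [`|Y - X|], so its expectation is that of
a nonnegative function. *)
Lemma expectation_ae_le X Y :
  P.-integrable setT (EFin \o X) -> P.-integrable setT (EFin \o Y) ->
  {ae P, forall w, X w <= Y w} -> ('E_P[X] <= 'E_P[Y])%E.
Proof.
move=> iX iY XY.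
have iXY : P.-integrable setT (EFin \o (Y \- X)).
  by have := integrableB measurableT iY iX; apply: eq_integrable.
have mXY := measurable_int _ iXY.
rewrite -sube_ge0; last first.
  by rewrite orbC expectation_fin_num//; exact/Lfun1_integrable.
rewrite -expectationB; try exact/Lfun1_integrable.
rewrite unlock.
rewrite (ae_eq_integral (abse \o (EFin \o (Y \- X))))//.
- by apply: integral_ge0 => w _; exact: abse_ge0.
- exact: measurable_int (integrable_abse iXY).
- apply: filterS XY => w XYw _ /=.
  by rewrite ger0_norm// subr_ge0.
Qed.

(** If the expectation of [X] vanished, then so would that of [`|X| = - X], and
[X = 0] would hold almost surely.  Under a probability an almost sure property
holds at some point, which contradicts [X < 0]. *)
Lemma expectation_lt0 X :
  P.-integrable setT (EFin \o X) -> (forall w, X w < 0) -> ('E_P[X] < 0)%E.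
Proof.
move=> iX X_lt0; have mX := measurable_int _ iX.
have abs_int : (\int[P]_w `|(EFin \o X) w| = - 'E_P[X])%E.
  rewrite unlock -integralN; last exact: integrable_add_def.
  by apply: eq_integral => w _ /=; rewrite ltr0_norm// EFinN.
rewrite lt_neqAle; apply/andP; split; last first.
  by rewrite -oppe_ge0 -abs_int; exact: integral_ge0.
apply/eqP => EX0.
have P_gt0 : (0 < P setT)%E by rewrite probability_setT lte01.
have aeP := ae_properfilter_algebraOfSetsType P_gt0.
have X_ae0 : ae_eq P setT (EFin \o X) (cst 0%E).
  by apply/ae_eq_integral_abs => //; rewrite abs_int EX0 oppe0.
have [w] := @filter_ex _ _ aeP _ X_ae0.
by move=> /(_ I) [Xw0]; have := X_lt0 w; rewrite Xw0 ltxx.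
Qed.

End Expectation.

Lemma marginal_disutility_lt0 (R : realType) (U : R -> R) (x : R) :
  utility U -> (\- U)^`() x < 0.
Proof.
by move=> [_ dU _ U'_gt0 _]; rewrite (derive1N (dU x)) oppr_lt0.
Qed.

Lemma marginal_costE (R : realType) (K a : R) : marginal_cost K a = K * a.
Proof.
rewrite /marginal_cost derive1E.
have -> : cost K = (K / 2) \*: ((@id R) ^+ 2).
  by apply/funext => x; rewrite /cost /= fctE/= mulrAC.
rewrite deriveZ//= deriveX//= derive_id /=.
by rewrite /GRing.scale/=; lra.
Qed.

Theorem mainTheorem3 (R : realType) (d : measure_display)
    (T : measurableType d) (P : probability T R)
    (T_uncountable : ~ countable [set: T])
    (B : L2 P) (x0 K : R) (K_gt0 : 0 < K)
    (UP UA : R -> R) (UP_utility : utility UP) (UA_utility : utility UA)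
    (UA_lim : UA x @[x --> -oo] --> -oo)
    (y m : R) (m_ge0 : 0 <= m) (m_le_y : m <= y)
    (UP_finite : ('E_P[fun w => `|UP (outcome x0 B 0 w - y)|%R] < +oo)%E)
    (UP_gateaux :
       gateaux_differentiable (@principal_utility _ T R P UP x0 B))
    (UA_gateaux : gateaux_differentiable (@agent_utility _ T R P UA K))
    (W : L2 P) (a lam : R) (Z : L2 P)
    (Wa_max : maximizer UP UA x0 B K y m ((W, a) : contracts P R))
    (multipliers : lagrange_multipliers UP UA x0 B K y m W a lam Z) :
  [/\ agent_utility UA K ((W, a) : contracts P R) = (UA y)%:E,
      {ae P, forall w, Z w = 0 ->
         lam = marginal_principal UP x0 B W a w / marginal_agent UA K W a w
               * \1_[set w' | Z w' = 0] w} &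
      1 / K <= a].
Proof.
case: multipliers => -[lam_ge0 Z_ge0] [iP iA iUA _] stat_a stat_W [slack _].
set p := marginal_principal UP x0 B W a in iP stat_a stat_W *.
set q := marginal_agent UA K W a in iA stat_a stat_W *.
have p_lt0 w : p w < 0 by exact: marginal_disutility_lt0.
have q_lt0 w : q w < 0 by exact: marginal_disutility_lt0.
have Ep_lt0 := expectation_lt0 iP p_lt0.
have Eq_lt0 := expectation_lt0 iA q_lt0.
have p_le : {ae P, forall w, p w <= (lam \o* q) w}.
  by apply: filterS2 Z_ge0 stat_W => w /= ? ?; lra.
have ilq : P.-integrable setT (EFin \o (lam \o* q)).
  by apply/Lfun1_integrable/Lfun_scale => //; exact/Lfun1_integrable.
have Ep_le := expectation_ae_le iP ilq p_le.
rewrite expectationZl in Ep_le; last exact/Lfun1_integrable.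
have Ep_fin : 'E_P[p]%E \is a fin_num.
  by apply: expectation_fin_num; exact/Lfun1_integrable.
have Eq_fin : 'E_P[q]%E \is a fin_num.
  by apply: expectation_fin_num; exact/Lfun1_integrable.
rewrite marginal_costE in stat_a.
move: stat_a Ep_lt0 Eq_lt0 Ep_le.
rewrite -(fineK Ep_fin) -(fineK Eq_fin) -!EFinM -EFinB !lte_fin lee_fin.
move: (fine 'E_P[p]%E) (fine 'E_P[q]%E) => Ep Eq [/eqP].
rewrite subr_eq0 => /eqP Ep_def.
rewrite {}Ep_def => Ep_lt0 Eq_lt0 Ep_le.
have lam_neq0 : lam != 0.
  by apply: contraTneq Ep_lt0 => ->; rewrite !mul0r ltxx.
have lam_gt0 : 0 < lam by rewrite lt_def lam_neq0.
split.
- have U_fin : agent_utility UA K ((W, a) : contracts P R) \is a fin_num.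
    by apply: expectation_fin_num; exact/Lfun1_integrable.
  move: slack; rewrite -(fineK U_fin) -EFinB -EFinM => -[/eqP].
  by rewrite mulf_eq0 (negbTE lam_neq0) subr_eq0 => /eqP ->.
- apply: filterS stat_W => w /= p_lamq Zw0.
  rewrite indicE mem_set// mulr1.
  have -> : p w = lam * q w by lra.
  by rewrite mulfK// lt_eqF.
- have lamEq_lt0 : lam * Eq < 0 by rewrite pmulr_rlt0.
  rewrite ler_pdivrMr// -(ler_nM2r lamEq_lt0) mul1r.
  by have -> : a * K * (lam * Eq) = lam * (K * a) * Eq by ring.
Qed.
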